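(* Let $n\ge 2$ and $k>1$ be integers. The group $G=\mathbb{Z}_n\,\mathrm{wr}\,\mathbb{Z}^k$ has a finitely generated subgroup $H$ with distortion at least $l^{k}$, i.e. $\Delta_H^G(l)\succeq l^k$.
   Context: $\mathbb{Z}_n=\mathbb{Z}/n\mathbb{Z}$, and $A\,\mathrm{wr}\,B$ denotes the restricted wreath product $W\rtimes B$ with $W=\bigoplus_{g\in B}A_g$ the direct sum of copies of $A$ permuted by $B$ via translation. For a group $G$ with finite generating set $T$ and a subgroup $H$ with finite generating set $S$, the distortion function is $\Delta_H^G(l)=\max\{|w|_S : w\in H, |w|_T\le l\}$. For non-decreasing functions $f,g$ on the nonnegative integers, $f\preceq g$ (equivalently $g\succeq f$) means there is an integer $C>0$ with $f(l)\le Cg(Cl)$ for all $l\ge 0$. *)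

(* Defs.v *)
From HB Require Import structures.
From mathcomp Require Import all_boot all_order all_algebra finmap all_classical.

Set Implicit Arguments.
Unset Strict Implicit.
Unset Printing Implicit Defensive.

Import GRing.Theory.
Local Open Scope fset_scope.
Local Open Scope ring_scope.

Section DirectSum.
Variables A B : zmodType.

(* Elements of the direct sum of copies of A indexed by B are the finitely
   supported functions from B to A. *)
Definition dsum : Type := {fsfun B -> A with 0}.
HB.instance Definition _ := Choice.on dsum.

Implicit Types (f g : dsum) (b x : B).

Definition dsum_add f g : dsum :=
  [fsfun x in finsupp f `|` finsupp g => f x + g x].

Definition dsum_opp f : dsum :=
  [fsfun x in finsupp f => - f x].

Definition translate b f : dsum :=
  [fsfun x in [fset (y + b)%R | y in finsupp f] =>
     f (x - b)].

Lemma dsumP f g : f =1 g <-> f = g.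
Proof. exact: fsfunP. Qed.

Lemma dsum_addE f g x : dsum_add f g x = f x + g x.
Proof.
rewrite fsfun_fun in_fsetU.
case: ifPn => //; rewrite negb_or => /andP[fx gx].
by rewrite !fsfun_dflt // addr0.
Qed.

Lemma dsum_oppE f x : dsum_opp f x = - f x.
Proof.
rewrite fsfun_fun.
by case: ifPn => // fx; rewrite fsfun_dflt // oppr0.
Qed.

Lemma translateE b f x : translate b f x = f (x - b).
Proof.
rewrite fsfun_fun; case: ifPn => // fx.
rewrite fsfun_dflt //; apply: contra fx => fx.
by apply/imfsetP; exists (x - b) => //=; rewrite subrK.
Qed.

Lemma dsum0E x : ([fsfun] : dsum) x = 0.
Proof. by rewrite fsfun0E. Qed.

Lemma dsum_addA : associative dsum_add.
Proof. by move=> f g h; apply/dsumP => x; rewrite !dsum_addE addrA. Qed.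

Lemma dsum_add0 : left_id ([fsfun] : dsum) dsum_add.
Proof. by move=> f; apply/dsumP => x; rewrite dsum_addE dsum0E add0r. Qed.

Lemma dsum_addC : commutative dsum_add.
Proof. by move=> f g; apply/dsumP => x; rewrite !dsum_addE addrC. Qed.

Lemma dsum_addN : left_inverse ([fsfun] : dsum) dsum_opp dsum_add.
Proof.
by move=> f; apply/dsumP => x; rewrite dsum_addE dsum_oppE dsum0E addNr.
Qed.

HB.instance Definition _ :=
  GRing.isZmodule.Build dsum dsum_addA dsum_addC dsum_add0 dsum_addN.

End DirectSum.

Section Wreath.
Variables A B : zmodType.

(* A and B are abelian and written additively; the semidirect product of
   dsum A B by B (acting by translation) is a multiplicative groupType. *)
Definition wreath : Type := (dsum A B * B)%type.
HB.instance Definition _ := Choice.on wreath.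

Implicit Types u v : wreath.

Definition wreath_one : wreath := (0, 0).
Definition wreath_mul u v : wreath := (u.1 + translate u.2 v.1, u.2 + v.2).
Definition wreath_inv u : wreath := (translate (- u.2) (- u.1), - u.2).

Lemma dsumDE (f g : dsum A B) x : (f + g) x = f x + g x.
Proof. exact: dsum_addE. Qed.

Lemma dsumNE (f : dsum A B) x : (- f) x = - f x.
Proof. exact: dsum_oppE. Qed.

Lemma dsumzE x : (0 : dsum A B) x = 0.
Proof. exact: dsum0E. Qed.

Definition wreathE := (dsumDE, dsumNE, dsumzE, translateE).

Lemma wreath_mulA : associative wreath_mul.
Proof.
move=> u v w; congr (_, _); last exact: addrA.
apply/dsumP => x; rewrite /wreath_mul /=.
by rewrite !wreathE opprD !addrA.
Qed.

Lemma wreath_mul1 : left_id wreath_one wreath_mul.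
Proof.
move=> [f b]; congr (_, _); last exact: add0r.
by apply/dsumP => x; rewrite /= !wreathE subr0 add0r.
Qed.

Lemma wreath_mulr1 : right_id wreath_one wreath_mul.
Proof.
move=> [f b]; congr (_, _); last exact: addr0.
by apply/dsumP => x; rewrite /= !wreathE addr0.
Qed.

Lemma wreath_mulV : left_inverse wreath_one wreath_inv wreath_mul.
Proof.
move=> [f b]; congr (_, _); last exact: addNr.
by apply/dsumP => x; rewrite /= !wreathE addNr.
Qed.

Lemma wreath_mulrV : right_inverse wreath_one wreath_inv wreath_mul.
Proof.
move=> [f b]; congr (_, _); last exact: addrN.
by apply/dsumP => x; rewrite /= !wreathE opprK subrK addrN.
Qed.

HB.instance Definition _ := isGroup.Build wreath
  wreath_mulA wreath_mul1 wreath_mulr1 wreath_mulV wreath_mulrV.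

End Wreath.

Section Distortion.
Variable G : groupType.
Implicit Types (S T s : seq G) (H K : {pred G}).

Definition generates S H : Prop :=
  [/\ group_closed H, {subset S <= H} &
      forall K, group_closed K -> {subset S <= K} -> {subset H <= K}].

Definition finitely_generated H : Prop := exists S, generates S H.

Definition has_word S (w : G) (m : nat) : Prop :=
  exists s, [/\ size s = m, {in s, forall x, (x \in S) || (x^-1%g \in S)} &
                (\prod_(x <- s) x)%g = w].

(* Junk value 0 when w is not in the subgroup generated by S. *)
Definition word_length S (w : G) : nat :=
  if pselect (exists m, `[< has_word S w m >]) is left wP then ex_minn wP
  else 0%N.

(* The maximum ranges over a finite set as soon as T generates G. *)
Definition distortion H S T (l : nat) : nat :=
  \big[maxn/0%N]_(w \in [set w : G | w \in H /\ (word_length T w <= l)%N]%classic)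
    word_length S w.

End Distortion.

Definition preceq (f g : nat -> nat) : Prop :=
  exists2 C : nat, (0 < C)%N & forall l : nat, (f l <= C * g (C * l))%N.

(* Main.v *)
(* The subgroup H is the image of the injective endomorphism
   (f, b) |-> (P f, b) of G, where P f is the convolution of f with
   (1 - x_1) ... (1 - x_k).  For a nonzero and P f = (1 - x_1^l) ... (1 - x_k^l) a,
   the function f is a times the indicator of a box with l^k points, so (P f, 0)
   has length at least of order l^k in H because a generator of H changes
   boundedly many lamps.  In G, however, (P f, 0) is the iterated commutator
   of a with x_1^l, ..., x_k^l, whose length is O(l). *)
Require Import Defs.
From mathcomp Require Import all_boot all_order all_algebra finmap all_classical.
From mathcomp Require Import zify.

Set Implicit Arguments.
Unset Strict Implicit.
Unset Printing Implicit Defensive.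

(** * Words, word length and distortion in a group *)

Section Words.
Variable G : groupType.
Implicit Types (S T s : seq G) (H K : {pred G}) (u v w : G) (m p l : nat).

Lemma has_word0 S : has_word S 1%g 0.
Proof. by exists [::]; rewrite big_nil. Qed.

Lemma has_word1 S u : u \in S -> has_word S u 1.
Proof.
move=> uS; exists [:: u]; split=> //; last by rewrite big_seq1.
by move=> x; rewrite inE => /eqP->; rewrite uS.
Qed.

Lemma has_wordM S u v m p :
  has_word S u m -> has_word S v p -> has_word S (u * v)%g (m + p).
Proof.
move=> [s [<- sS <-]] [t [<- tS <-]]; exists (s ++ t).
rewrite size_cat big_cat; split=> // x.
by rewrite mem_cat => /orP[/sS|/tS].
Qed.

Lemma has_wordV S u m : has_word S u m -> has_word S u^-1%g m.
Proof.
move=> [s [<- sS <-]] {u m}; elim: s sS => [|x s IHs] sS.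
  by rewrite big_nil invg1; apply: has_word0.
rewrite big_cons invgM /= -addn1; apply: has_wordM.
  by apply: IHs => y ys; apply: sS; rewrite inE ys orbT.
exists [:: x^-1%g]; split=> //; last by rewrite big_seq1.
by move=> y; rewrite inE => /eqP->; rewrite invgK orbC sS ?mem_head.
Qed.

(** The elements that have a word in [S] form a subgroup containing [S], so the minimality clause
    for [H] applies to it. *)
Lemma generated_has_word S H w :
  generates S H -> w \in H -> exists m, has_word S w m.
Proof.
move=> [_ _ Hmin] wH.
have : w \in [pred v | `[< exists m, has_word S v m >]].
  apply: Hmin wH; last by move=> x xS; apply/asboolP; exists 1; apply: has_word1.
  split; first by apply/asboolP; exists 0; apply: has_word0.
  move=> u v /asboolP[m um] /asboolP[p vp]; apply/asboolP; exists (m + p).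
  exact/has_wordM/has_wordV.
by move/asboolP.
Qed.

Lemma word_length_has_word S H w :
  generates S H -> w \in H -> has_word S w (word_length S w).
Proof.
move=> SH wH; rewrite /word_length; case: pselect => [wP|[]].
  by case: ex_minnP => m /asboolP.
by have [m wm] := generated_has_word SH wH; exists m; apply/asboolP.
Qed.

Lemma word_length_le S w m : has_word S w m -> word_length S w <= m.
Proof.
move=> wm; rewrite /word_length; case: pselect => // wP.
by case: ex_minnP => p _; apply; apply/asboolP.
Qed.

Lemma has_word_finite S m : finite_set [set w | has_word S w m]%classic.
Proof.
elim: m => [|m IHm].
  apply: (@sub_finite_set _ _ [set 1%g]%classic) => // w [s [/size0nil-> _ <-]].
  by rewrite big_nil.
have finS := finite_seq (S ++ [seq x^-1%g | x <- S]).
apply: sub_finite_set (finite_image2 (fun u v => (u * v)%g) finS IHm).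
move=> w [[|x s] [//= [sm] sS <-]]; rewrite big_cons.
exists x.
  rewrite /= mem_cat; have /orP[->//|xS] := sS x (mem_head _ _).
  by apply/orP; right; apply/mapP; exists x^-1%g; rewrite ?invgK.
exists (\prod_(y <- s) y)%g => //; exists s; split=> // y ys.
by apply: sS; rewrite inE ys orbT.
Qed.

Section GeneratingSet.
Variable T : seq G.
Hypothesis genT : generates T (predT : {pred G}).

Let word_lengthP w : has_word T w (word_length T w).
Proof. exact: word_length_has_word genT _. Qed.

Lemma word_lengthM u v :
  word_length T (u * v)%g <= word_length T u + word_length T v.
Proof. by apply/word_length_le/has_wordM. Qed.

Lemma word_lengthV u : word_length T u^-1%g <= word_length T u.
Proof. by apply/word_length_le/has_wordV. Qed.

Lemma word_length_commg u v :
  word_length T (u * v * (u^-1 * v^-1))%g <= 2 * word_length T u + 2 * word_length T v.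
Proof.
rewrite -mulnDr mul2n -addnn; apply: leq_trans (word_lengthM _ _) _.
apply: leq_add; apply: leq_trans (word_lengthM _ _) _ => //.
by apply: leq_add; apply: word_lengthV.
Qed.

Lemma word_lengthX u m : word_length T (u ^+ m)%g <= m * word_length T u.
Proof.
elim: m => [|m IHm]; first by rewrite expg0; apply/word_length_le/has_word0.
by rewrite expgS mulSn (leq_trans (word_lengthM _ _)) ?leq_add2l.
Qed.

Lemma word_length_ball_finite l :
  finite_set [set w | word_length T w <= l]%classic.
Proof.
elim: l => [|l IHl].
  apply: sub_finite_set (has_word_finite T 0) => w /=.
  by rewrite leqn0 => /eqP <-; apply: word_lengthP.
apply: (@sub_finite_set _ _
  ([set w | word_length T w <= l] `|` [set w | has_word T w l.+1])%classic).
  move=> w /=; rewrite leq_eqVlt ltnS => /orP[/eqP<-|]; [right|by left].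
  exact: word_lengthP.
by rewrite finite_setU; split=> //; apply: has_word_finite.
Qed.

Lemma distortion_ge H S l w :
  w \in H -> word_length T w <= l -> word_length S w <= distortion H S T l.
Proof.
(* The big maximum runs over the elements of nonzero value only, and collapses to 0 if these are
   infinitely many; hence the separate zero case and the appeal to finite balls. *)
move=> wH wl; have [->//|/eqP Sw] := eqVneq (word_length S w) 0.
apply: (@leq_bigmax_seq _ _ _ (fun v => word_length S v)) => //.
rewrite in_finite_support; first by rewrite inE.
apply/finite_setIl/(sub_finite_set _ (word_length_ball_finite l)).
by move=> v [].
Qed.

End GeneratingSet.

End Words.

(** * Images of finitely generated groups *)

Section Morphism.
Variables (G K : groupType) (phi : G -> K).
Hypothesis phiM : {morph phi : x y / (x * y)%g}.

Lemma morph_unit : phi 1%g = 1%g.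
Proof. by apply: (mulgI (phi 1%g)); rewrite -phiM !mulg1. Qed.

Lemma morph_inv u : phi u^-1%g = (phi u)^-1%g.
Proof. by apply: (mulgI (phi u)); rewrite -phiM !mulgV morph_unit. Qed.

Lemma generates_image (S : seq G) :
  generates S (predT : {pred G}) ->
  generates (map phi S) [pred g | `[< exists u, phi u = g >]].
Proof.
move=> [_ _ Smin]; split.
- split; first by apply/asboolP; exists 1%g; apply: morph_unit.
  move=> _ _ /asboolP[u <-] /asboolP[v <-].
  by apply/asboolP; exists (u / v)%g; rewrite phiM morph_inv.
- by move=> _ /mapP[u _ ->]; apply/asboolP; exists u.
move=> L [L1 LV] SL _ /asboolP[u <-].
(* Minimality is transferred by pulling [L] back along [phi]. *)
apply: (Smin [pred v | phi v \in L]) => //.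
  split=> [|v w]; first by rewrite inE morph_unit.
  by rewrite !inE phiM morph_inv; apply: LV.
by move=> v vS; apply/SL/map_f.
Qed.

End Morphism.

Import GRing.Theory Num.Theory.
Local Open Scope ring_scope.

(** * Difference and geometric-sum operators on lamp functions *)

Section Convolution.
Variables A B : zmodType.
Implicit Types (f g : dsum A B) (b c x : B) (bs : seq B) (l j : nat).

Lemma dsum_sumE I (r : seq I) (F : I -> dsum A B) x :
  (\sum_(i <- r) F i) x = \sum_(i <- r) F i x.
Proof.
by rewrite (big_morph (fun f : dsum A B => f x) (fun f g => dsumDE f g x) (dsumzE A x)).
Qed.

Definition lamp x (a : A) : dsum A B := [fsfun y in [fset x]%fset => a].

Lemma lampE x a y : lamp x a y = if y == x then a else 0.
Proof. by rewrite fsfun_fun in_fset1. Qed.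

(** With lamp functions seen as a module over the group ring of [B], this is multiplication by 1 -
    x^b. *)
Definition diff b f : dsum A B := f - translate b f.
Definition diffs bs f := foldr diff f bs.

Lemma diffE b f x : diff b f x = f x - f (x - b).
Proof. by rewrite !wreathE. Qed.

(** Multiplication by the geometric sum 1 + y + ... + y^(l-1), where y = x^b. *)
Definition progr_sum l b f : dsum A B := \sum_(j < l) translate (b *+ j) f.
Definition progr_sums l bs f := foldr (progr_sum l) f bs.

Lemma progr_sumE l b f x : progr_sum l b f x = \sum_(j < l) f (x - b *+ j).
Proof. by rewrite dsum_sumE; apply: eq_bigr => j _; rewrite translateE. Qed.

Lemma diff_progr_sumC b l c f :
  diff b (progr_sum l c f) = progr_sum l c (diff b f).
Proof.
apply/dsumP => x; rewrite diffE !progr_sumE -sumrB; apply: eq_bigr => j _.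
by rewrite diffE addrAC.
Qed.

Lemma diffs_progr_sumC bs l c f :
  diffs bs (progr_sum l c f) = progr_sum l c (diffs bs f).
Proof. by elim: bs => //= b bs ->; rewrite diff_progr_sumC. Qed.

(** Telescoping: (1 - y)(1 + y + ... + y^(l-1)) = 1 - y^l. *)
Lemma diff_progr_sum l b f : diff b (progr_sum l b f) = diff (b *+ l) f.
Proof.
apply/dsumP => x; rewrite !diffE !progr_sumE.
elim: l => [|l IHl]; first by rewrite !big_ord0 mulr0n !subr0 subrr.
rewrite !big_ord_recr /= opprD addrACA IHl.
by rewrite addrA subrK mulrS opprD addrA.
Qed.

(** The operators commute, so the telescoping can be done one direction at a time. This exhibits an
    explicit preimage under [diffs bs] of the iterated commutator. *)
Lemma diffs_progr_sums l bs f :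
  diffs bs (progr_sums l bs f) = diffs [seq b *+ l | b <- bs] f.
Proof.
elim: bs => //= b bs IHbs.
by rewrite diffs_progr_sumC diff_progr_sum IHbs.
Qed.

Lemma diffD b f g : diff b (f + g) = diff b f + diff b g.
Proof. by apply/dsumP => x; rewrite [RHS]dsumDE !diffE !dsumDE opprD addrACA. Qed.

Lemma diffsD bs f g : diffs bs (f + g) = diffs bs f + diffs bs g.
Proof. by elim: bs => //= b bs ->; rewrite diffD. Qed.

Lemma diff_translate b c f : diff b (translate c f) = translate c (diff b f).
Proof. by apply/dsumP => x; rewrite diffE !translateE diffE addrAC. Qed.

Lemma diffs_translate bs c f :
  diffs bs (translate c f) = translate c (diffs bs f).
Proof. by elim: bs => //= b bs ->; rewrite diff_translate. Qed.

(* If b has infinite order, a function equal to its translate by b is constant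
   on an infinite progression, hence zero as its support is finite. *)
Lemma diff_inj b : injective (fun j => b *+ j) -> injective (diff b).
Proof.
move=> b_inj f g eq_fg; apply/subr0_eq/dsumP => x.
have step y : (f - g) y = (f - g) (y - b).
  have := congr1 (fun h : dsum A B => h y) eq_fg; rewrite /= !diffE !wreathE.
  by move=> /(canRL (subrK _)) ->; rewrite addrAC (addrAC (g y)) subrr add0r addrC.
set h := f - g in step *.
have iterE j : h x = h (x - b *+ j).
  elim: j => [|j ->]; first by rewrite mulr0n subr0.
  by rewrite step mulrSr opprD addrA.
rewrite dsumzE; apply/eqP; apply: contraT => hx.
pose F (j : 'I_(#|` finsupp h|).+1) := x - b *+ j.
have F_inj : injective F by move=> i j /addrI/oppr_inj/b_inj/val_inj.
have := uniq_leq_size (s1 := map F (enum 'I_(#|` finsupp h|).+1))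
  (s2 := finsupp h).
rewrite map_inj_uniq // enum_uniq size_map size_enum_ord ltnn.
apply=> // _ /mapP[j _ ->]; rewrite mem_finsupp -iterE //.
Qed.

Lemma diffs_inj bs :
  {in bs, forall b, injective (fun j => b *+ j)} -> injective (diffs bs).
Proof.
elim: bs => [|b bs IHbs] bs_inj f g //= /diff_inj eq_fg.
apply: IHbs; first by move=> c cbs; apply: bs_inj; rewrite inE cbs orbT.
by apply: eq_fg; apply: bs_inj; apply: mem_head.
Qed.

(** Subadditive and not increased by inversion, so it bounds word length from below up to a constant
    factor. *)
Definition supp_size (u : wreath A B) : nat := #|` finsupp u.1|.

Lemma supp_size_translate b f : (#|` finsupp (translate b f)| <= #|` finsupp f|)%N.
Proof.
apply: leq_trans (_ : #|` [fset (x + b)%R | x in finsupp f]%fset| <= _)%N.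
  apply/fsubset_leq_card/fsubsetP => x; rewrite mem_finsupp translateE => fx.
  by apply/imfsetP; exists (x - b); rewrite ?subrK //= mem_finsupp.
exact: leq_imfset_card.
Qed.

Lemma supp_sizeM u v : (supp_size (u * v)%g <= supp_size u + supp_size v)%N.
Proof.
apply: leq_trans (leq_add (leqnn _) (supp_size_translate u.2 v.1)).
apply: leq_trans (_ : #|` (finsupp u.1 `|` finsupp (translate u.2 v.1))%fset| <= _)%N.
  apply/fsubset_leq_card/fsubsetP => x; rewrite in_fsetU !mem_finsupp /= dsumDE.
  apply: contraR; rewrite negb_or !negbK => /andP[/eqP-> /eqP->].
  by rewrite addr0.
by rewrite -cardfsUI leq_addr.
Qed.

Lemma supp_sizeV u : (supp_size u^-1%g <= supp_size u)%N.
Proof.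
apply: leq_trans (supp_size_translate _ _) _.
apply/fsubset_leq_card/fsubsetP => x; rewrite !mem_finsupp dsumNE.
by rewrite oppr_eq0.
Qed.

Definition diffs_wreath bs (u : wreath A B) : wreath A B := (diffs bs u.1, u.2).

Lemma diffs_wreathM bs : {morph diffs_wreath bs : u v / (u * v)%g}.
Proof. by move=> u v; congr (_, _); rewrite /= diffsD diffs_translate. Qed.

(** Conjugation by [v] translates the lamps of [u] by [b], so the commutator subtracts from [f] its
    translate. *)
Lemma diff_commg b f (u : wreath A B := (f, 0)) (v : wreath A B := (0, b)) :
  (diff b f, 0) = (u * v * (u^-1 * v^-1))%g.
Proof.
congr (_, _); last by rewrite /= !(oppr0, addr0, add0r) subrr.
by apply/dsumP => x; rewrite /= diffE !wreathE !(oppr0, addr0, subr0, add0r).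
Qed.

Lemma wreath_pure_expg b l : (((0%R, b) : wreath A B) ^+ l)%g = (0, b *+ l).
Proof.
elim: l => [|l IHl]; first by rewrite expg0 mulr0n.
rewrite expgS IHl mulrS; congr (_, _).
by apply/dsumP => x; rewrite /= !wreathE addr0.
Qed.

(** Each direction costs one commutator, which at most doubles the previous length and adds 2l times
    the length of [(0, b)]. As [bs] is fixed, the bound stays linear in [l]. *)
Lemma word_length_diffs (T : seq (wreath A B)) bs f :
  generates T (predT : {pred wreath A B}) ->
  exists C, forall l, (0 < l)%N ->
    (word_length T (diffs [seq b *+ l | b <- bs] f, 0%R) <= C * l)%N.
Proof.
move=> genT; elim: bs => [|b bs [C IHbs]].
  by exists (word_length T (f, 0)) => l l_gt0; rewrite leq_pmulr.
exists (2 * C + 2 * word_length T (0%R, b))%N => l l_gt0 /=.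
rewrite diff_commg; set u := (_, 0) : wreath A B.
have ul : (word_length T u <= C * l)%N by apply: IHbs.
set v := (0, b *+ l) : wreath A B.
have vl : (word_length T v <= l * word_length T (0%R, b))%N.
  by rewrite /v -wreath_pure_expg; apply: word_lengthX.
apply: leq_trans (word_length_commg genT u v) _.
by rewrite mulnDl -!mulnA leq_add ?leq_mul2l //= mulnC.
Qed.

(* A word of length m in the generators changes at most C m lamps, where C bounds
   the supports of preimages of the generators. *)
Lemma word_length_image_ge (S : seq (wreath A B)) bs :
  injective (diffs bs) ->
  generates S [pred g | `[< exists u, diffs_wreath bs u = g >]] ->
  exists C, forall f,
    (#|` finsupp f| <= C * word_length S (diffs bs f, 0%R))%N.
Proof.
move=> bs_inj genS; have [_ SH _] := genS.
pose section (w : wreath A B) : wreath A B :=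
  if pselect (exists u, diffs_wreath bs u = w) is left wP
  then projT1 (cid wP) else 1%g.
have sectionK s : s \in S -> diffs_wreath bs (section s) = s.
  move=> /SH/asboolP sP; rewrite /section; case: pselect => // {}sP.
  by case: cid.
pose C := (\max_(s <- S) supp_size (section s))%N.
(* A word is lifted letter by letter through [section]; an inverse letter lifts to the inverse of a
   lift. *)
have wordP m w : has_word S w m ->
    exists u, diffs_wreath bs u = w /\ (supp_size u <= C * m)%N.
  move=> [s [<- sS <-]]; elim: s sS => [|x s IHs] sS.
    exists 1%g; split; first by rewrite big_nil (morph_unit (diffs_wreathM bs)).
    by rewrite /supp_size /= finsupp0 cardfs0.
  rewrite big_cons.
  have /IHs[u [<- uC]] : {in s, forall y, (y \in S) || (y^-1%g \in S)}.
    by move=> y ys; apply: sS; rewrite inE ys orbT.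
  have le_C y : y \in S -> (supp_size (section y) <= C)%N.
    by move=> yS; apply: (leq_bigmax_seq (F := fun s => supp_size (section s))).
  have [v [<- vC]] : exists v, diffs_wreath bs v = x /\ (supp_size v <= C)%N.
    have /orP[xS|xS] := sS x (mem_head _ _).
      by exists (section x); rewrite sectionK ?le_C.
    exists (section x^-1%g)^-1%g; split.
      by rewrite (morph_inv (diffs_wreathM bs)) sectionK ?invgK.
    by apply: leq_trans (supp_sizeV _) _; apply: le_C.
  exists (v * u)%g; rewrite diffs_wreathM; split=> //=.
  by rewrite mulnS (leq_trans (supp_sizeM _ _)) ?leq_add.
exists C => f.
have fH : (diffs bs f, 0) \in [pred g | `[< exists u, diffs_wreath bs u = g >]].
  by apply/asboolP; exists (f, 0).
(* Injectivity of [diffs bs] identifies the lamps of the lifted word with [f]. *)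
have [[h b] [[/bs_inj <- _]]] := wordP _ _ (word_length_has_word genS fH).
by [].
Qed.

End Convolution.

(** * The lattice case: generators, boxes and the distortion bound *)

Section IntegerLattice.
Variables (A : finZmodType) (k : nat).
Local Notation B := 'rV[int]_k.
Local Notation G := (wreath A B).

Definition axis (i : 'I_k) : B := delta_mx 0 i.

Lemma axisE (i j : 'I_k) (m : nat) : (axis i *+ m) 0 j = if j == i then m%:Z else 0.
Proof.
by rewrite mulmxnE mxE eqxx /=; case: eqP => _; rewrite ?mul0rn //= mulr1n natz.
Qed.

Lemma axis_inj (i : 'I_k) : injective (fun m => axis i *+ m).
Proof.
by move=> m p /rowP/(_ i); rewrite !axisE eqxx => -[].
Qed.

Definition wreath_gens : seq G :=
  [seq (lamp (0 : B) a, 0) | a <- enum A] ++ [seq (0, axis i) | i <- enum 'I_k].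

(** The axis translations give all pure translations; conjugating by these moves a lamp from the
    origin to any site, and a finitely supported function is the sum of its lamps. *)
Lemma wreath_gensP : generates wreath_gens (predT : {pred G}).
Proof.
split=> // K Kgroup genK; have [K1 _] := Kgroup.
have KM := group_closedM Kgroup; have KV := group_closedV Kgroup.
have KX u (z : int) : (0, u) \in K -> ((0, u *~ z) : G) \in K.
  move=> uK; have posK m : ((0, u *+ m) : G) \in K.
    rewrite -wreath_pure_expg; elim: m => [|m IHm]; rewrite ?expg0 //.
    by rewrite expgS; apply: KM.
  case: z => m; first exact: posK.
  have := KV _ (posK m.+1); congr (_ \in K); congr (_, _).
  by apply/dsumP => x; rewrite /= !wreathE oppr0.
have K_D (f g : dsum A B) : ((f, 0) : G) \in K -> ((g, 0) : G) \in K ->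
      ((f + g, 0) : G) \in K.
  move=> fK gK; have := KM _ _ fK gK; congr (_ \in K); congr (_, _); rewrite /= ?addr0 //.
  by apply/dsumP => x; rewrite !wreathE subr0.
have Kpure (b : B) : ((0, b) : G) \in K.
  rewrite [b]row_sum_delta; elim/big_rec: _ => // i u _ uK.
  have iK : ((0, axis i) : G) \in K.
    by apply: genK; rewrite mem_cat map_f ?orbT // mem_enum.
  have := KM _ _ (KX _ (b 0 i) iK) uK; congr (_ \in K); congr (_, _).
    by apply/dsumP => x; rewrite /= !wreathE addr0.
  by rewrite /= -scaler_int intz.
have Klamp x a : ((lamp x a, 0) : G) \in K.
  have aK : ((lamp 0 a, 0) : G) \in K.
    by apply: genK; rewrite mem_cat map_f // mem_enum.
  have := KM _ _ (KM _ _ (Kpure x) aK) (KV _ (Kpure x)); congr (_ \in K); congr (_, _).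
    apply/dsumP => y; rewrite /= !wreathE !lampE subr_eq0.
    by rewrite oppr0 add0r addr0.
  by rewrite /= addr0 subrr.
move=> [f b] _.
have fK : ((f, 0) : G) \in K.
  have -> : f = \sum_(x <- finsupp f) lamp x (f x).
    apply/dsumP => y; rewrite dsum_sumE.
    under eq_bigr do rewrite lampE.
    case: finsuppP => [yf|yf].
      rewrite big1_seq // => x /andP[_ xf]; case: eqP => // yx.
      by rewrite -yx (negPf yf) in xf.
    rewrite (bigD1_seq y) ?fset_uniq //= eqxx big1 ?addr0 // => x.
    by rewrite eq_sym => /negPf ->.
  elim/big_rec: _ => // x g _ gK; exact: K_D.
have := KM _ _ fK (Kpure b); congr (_ \in K); congr (_, _); rewrite /= ?add0r //.
by apply/dsumP => x; rewrite !wreathE addr0.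
Qed.

(** Each geometric sum spreads the point mass at the origin over [l] sites along one axis. As the
    axes are distinct, no site is hit twice and the result is [a] times a box indicator. *)
Lemma progr_sums_axisE l (a : A) (s : seq 'I_k) (x : B) : uniq s ->
  progr_sums l [seq axis i | i <- s] (lamp 0 a) x =
  if [forall i, if i \in s then 0 <= x 0 i < l%:Z else x 0 i == 0] then a else 0.
Proof.
elim: s x => [|i s IHs] x /=.
  rewrite lampE => _; congr (if _ then _ else _).
  apply/eqP/forallP => [-> i|x0]; first by rewrite mxE.
  by apply/rowP => i; rewrite mxE; apply/eqP/x0.
move=> /andP[is_ s_uniq]; rewrite progr_sumE.
(* [R] gathers the conditions on the coordinates other than [i], which shifts along axis [i] leave
   unchanged. *)
pose R := [forall j, (j != i) ==> (if j \in s then 0 <= x 0 j < l%:Z else x 0 j == 0)].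
have coordE (m : nat) j :
    (x - axis i *+ m) 0 j = x 0 j - (if j == i then m%:Z else 0).
  by rewrite -axisE !mxE.
(* Since [i] is not in [s], coordinate [i] of the shifted point must vanish, so only the summand of
   index [x 0 i] can survive. *)
have RE (m : nat) :
    [forall j, if j \in s then 0 <= (x - axis i *+ m) 0 j < l%:Z
               else (x - axis i *+ m) 0 j == 0] = (x 0 i == m%:Z) && R.
  apply/forallP/andP => [xP|[xi /forallP RP] j].
    split.
      by have := xP i; rewrite (negPf is_) coordE eqxx subr_eq0.
    apply/forallP => j; apply/implyP => /negPf ji.
    by have := xP j; rewrite coordE ji subr0.
  have := RP j; rewrite coordE; case: (j =P i) => [->|_] /=.
    by rewrite (negPf is_) (eqP xi) subrr.
  by rewrite subr0.
under eq_bigr => j _ do rewrite IHs // RE.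
have -> : [forall j, if j \in i :: s then 0 <= x 0 j < l%:Z else x 0 j == 0]
        = (0 <= x 0 i < l%:Z) && R.
  apply/forallP/andP => [xP|[xi /forallP RP] j].
    split; first by have := xP i; rewrite mem_head.
    apply/forallP => j; apply/implyP => /negPf ji.
    by have := xP j; rewrite inE ji.
  by have := RP j; rewrite inE; case: (j =P i) => [->|].
case: R {RE}; last by rewrite andbF big1 // => j _; rewrite andbF.
rewrite andbT; case: ifP => [/andP[]|xi].
  case: (x 0 i) => // m _ ml; rewrite (bigD1 (Ordinal (ml : (m < l)%N))) //= eqxx.
  rewrite big1 ?addr0 // => j; rewrite -val_eqE /= eq_sym => /negPf jm.
  by rewrite eqz_nat jm.
rewrite big1 // => j _; case: eqP => //= xij.
by rewrite xij ltz_nat ltn_ord in xi.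
Qed.

Lemma box_supp_size l (a : A) : a != 0 ->
  (l ^ k <= #|` finsupp (progr_sums l [seq axis i | i <- enum 'I_k] (lamp 0 a))|)%N.
Proof.
(* [F] lists the l^k points of the box with coordinates from 0 to l - 1. *)
move=> a0; pose F (c : {ffun 'I_k -> 'I_l}) : B := \row_i (c i : nat)%:Z.
have F_inj : injective F.
  move=> c d /rowP cd; apply/ffunP => i; apply: val_inj.
  by have := cd i; rewrite !mxE => -[].
have := uniq_leq_size (s1 := map F (enum {ffun 'I_k -> 'I_l})) (s2 := finsupp _).
rewrite size_map -cardE card_ffun !card_ord; apply.
  by rewrite map_inj_uniq ?enum_uniq.
move=> _ /mapP[c _ ->]; rewrite mem_finsupp progr_sums_axisE ?enum_uniq //.
rewrite ifT //; apply/forallP => i; rewrite mem_enum inE mxE.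
by rewrite ltz_nat ltn_ord.
Qed.

Lemma wreath_lattice_distortion (a : A) : a != 0 -> (0 < k)%N ->
  finitely_generated (predT : {pred G}) /\
  exists H : {pred G},
    [/\ group_closed H, finitely_generated H &
        forall S T : seq G, generates S H -> generates T (predT : {pred G}) ->
          preceq (fun l : nat => l ^ k)%N (distortion H S T)].
Proof.
move=> a0 k_gt0; split; first by exists wreath_gens; apply: wreath_gensP.
pose bs := [seq axis i | i <- enum 'I_k].
have genH := generates_image (@diffs_wreathM A _ bs) wreath_gensP.
pose H : pred G := [pred g | `[< exists u, diffs_wreath bs u = g >]].
exists H.
split; [by case: genH | by exists (map (diffs_wreath bs) wreath_gens) |].
move=> S T genS genT.
have bs_inj : injective (@diffs A _ bs).
  by apply: diffs_inj => _ /mapP[i _ ->]; apply: axis_inj.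
have [C1 le_C1] := word_length_image_ge bs_inj genS.
have [C2 le_C2] := word_length_diffs bs (lamp 0 a) genT.
exists (C1 + C2).+1 => // l; have [->|l_gt0] := posnP l; first by rewrite exp0n.
apply: leq_trans (box_supp_size l a0) _; apply: leq_trans (le_C1 _) _.
apply: leq_mul; first by lia.
apply: (distortion_ge genT).
  by apply/asboolP; exists (progr_sums l bs (lamp 0 a), 0).
(* The image of the box function is rewritten as the iterated commutator, whose length in the whole
   group is at most [C2 * l]. *)
rewrite -/bs diffs_progr_sums; apply: leq_trans (le_C2 l l_gt0) _.
by rewrite leq_mul2r; apply/orP; right; lia.
Qed.

End IntegerLattice.

Local Open Scope nat_scope.

Theorem proposition1p7 (n k : nat) (hn : 2 <= n) (hk : 1 < k) :
  let G := wreath 'Z_n 'rV[int]_k in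
  finitely_generated (predT : {pred G}) /\
  exists H : {pred G},
    [/\ group_closed H, finitely_generated H &
        forall S T : seq G, generates S H -> generates T (predT : {pred G}) ->
          preceq (fun l : nat => l ^ k) (distortion H S T)].
Proof.
(* The nonzero lamp state is the unit of ['Z_n]. *)
exact: (wreath_lattice_distortion (oner_neq0 'Z_n) (ltnW hk)).
Qed.
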